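(* Let $\mu\in\mathcal P$ and $n\in\mathbb N$. For every $p\in\Pi_n$ there exists a best $d_{\sf L}$-approximation of $\mu$, given $p$. Moreover, for $x\in\Xi_n$, the measure $\delta_x^p$ is a best $d_{\sf L}$-approximation of $\mu$, given $p$, if and only if, for every $j=1,\ldots,n$, $$P_{j-1}<P_j\ \Longrightarrow\ \ell_{F_\mu^{-1},[P_{j-1},P_j]}(x_j)\le{\sf L}_\bullet(p),$$ and in this case $d_{\sf L}(\mu,\delta_x^p)=\omega\,{\sf L}_\bullet(p)$.
   Context: $\mathbb I\subset\mathbb R$ is a compact interval with Lebesgue measure $\lambda(\mathbb I)>0$, and $\mathcal P$ is the set of all Borel probability measures on $\mathbb I$. For $\mu\in\mathcal P$, $F_\mu(x)=\mu(\{y\in\mathbb I:y\le x\})$, $x\in\mathbb R$. Let $\omega=\max\{1,\lambda(\mathbb I)\}/\lambda(\mathbb I)$. The (normalized) Lévy distance is $$d_{\sf L}(\mu,\nu)=\omega\inf\{y\ge0: F_\mu(\cdot-y)-y\le F_\nu\le F_\mu(\cdot+y)+y\}.$$ For $n\in\mathbb N$: $\Xi_n=\{x\in\mathbb I^n:x_1\le\ldots\le x_n\}$; $\Pi_n=\{p\in\mathbb R^n:p_j\ge0,\ \sum_{j=1}^np_j=1\}$, with $P_i=\sum_{j=1}^ip_j$ for $i=0,\ldots,n$ (so $P_0=0$, $P_n=1$); $\delta_x^p=\sum_{j=1}^np_j\delta_{x_j}$, where $\delta_a$ is the Dirac measure at $a$. Given $p\in\Pi_n$, $\delta_x^p$ is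 a best $d_{\sf L}$-approximation of $\mu$, given $p$, if $d_{\sf L}(\mu,\delta_x^p)\le d_{\sf L}(\mu,\delta_y^p)$ for all $y\in\Xi_n$. For non-decreasing $f:\mathbb R\to\overline{\mathbb R}=\mathbb R\cup\{\pm\infty\}$, put $f_\pm(x)=\lim_{\varepsilon\downarrow0}f(x\pm\varepsilon)$ for $x\in\mathbb R$, and let $f^{-1}:\mathbb R\to\overline{\mathbb R}$, $f^{-1}(t)=\sup\{x\in\mathbb R:f(x)\le t\}$, with $\sup\varnothing=-\infty$. In particular $F_\mu^{-1}:\mathbb R\to\overline{\mathbb R}$ is non-decreasing and right-continuous, equal to $-\infty$ on $]-\infty,0[$ and to $+\infty$ on $[1,+\infty[$. For an interval $J\subset\overline{\mathbb R}$ with $f_-(\sup J)<+\infty$ and $-f_+(\inf J)<+\infty$, define for $x\in\mathbb R$ $$\ell_{f,J}(x)=\inf\{y\ge0: f_-(\sup J-y)-y\le x\le f_+(\inf J+y)+y\},\qquad \ell_{f,J}^*=\min_{x\in\mathbb R}\ell_{f,J}(x).$$ (These are well-defined for $f=F_\mu^{-1}$ and every $J\subset[0,1]$; one-point intervals are allowed.) For $p\in\Pi_n$, ${\sf L}_\bullet(p)=\max_{j=1}^n\ell^*_{F_\mu^{-1},[P_{j-1},P_j]}$. *)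

(* Defs.v *)
From HB Require Import structures.
From mathcomp Require Import all_boot all_order all_algebra.
From mathcomp Require Import all_classical all_reals all_analysis.

Set Implicit Arguments.
Unset Strict Implicit.
Unset Printing Implicit Defensive.
Import Order.TTheory GRing.Theory Num.Theory.
Import numFieldNormedType.Exports.
Local Open Scope classical_set_scope.
Local Open Scope ring_scope.

(* A Borel probability measure on an interval I of R is represented by a
   Borel probability mu on R with mu I = 1. *)
Section levy.
Context {R : realType}.
Implicit Types (I : set R) (mu nu : probability (measurableTypeR R) R).

Definition distr_fun I mu (x : R) : \bar R := mu [set y | I y /\ y <= x].

Definition omega I : R :=
  let len := fine (lebesgue_measure I) in Num.max 1 len / len.

(* The set below contains y = 1, so the real-valued infimum is genuine. *)
Definition levy_dist I mu nu : R :=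
  omega I * inf [set y : R | 0 <= y /\
    forall x : R,
      (distr_fun I mu (x - y) - y%:E <= distr_fun I nu x)%E /\
      (distr_fun I nu x <= distr_fun I mu (x + y) + y%:E)%E].

End levy.

Section simplex.
Context {R : realType}.

Record simplex n := Simplex {
  weight :> 'I_n -> R ;
  weight_ge0 : forall j, 0 <= weight j ;
  weight_sum1 : \sum_(j < n) weight j = 1 }.

(* P_i, for 0 <= i <= n; the indices j of p_j start from 0 here, so the
   interval [P_{j-1}, P_j] of the j-th atom becomes [P_j, P_{j+1}]. *)
Definition psum n (p : simplex n) (i : nat) : R := \sum_(j < n | (j < i)%N) p j.

Definition Xi (I : set R) n : set ('I_n -> R) :=
  [set x | (forall j, I (x j)) /\ (forall i j : 'I_n, (i <= j)%N -> x i <= x j)].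

Definition atoms n (p : simplex n) (x : 'I_n -> R)
    (A : set (measurableTypeR R)) : \bar R :=
  (\sum_(j < n) (p j)%:E * \d_(x j) A)%E.

Section atoms_probability.
Context n (p : simplex n) (x : 'I_n -> R).

Let atoms0 : atoms p x set0 = 0%E.
Proof. by rewrite /atoms big1// => j _; rewrite measure0 mule0. Qed.

Let atoms_ge0 A : (0 <= atoms p x A)%E.
Proof.
by apply: sume_ge0 => j _; apply: mule_ge0 => //; rewrite lee_fin weight_ge0.
Qed.

Let atoms_sigma_additive : semi_sigma_additive (atoms p x).
Proof.
move=> F mF tF mUF; rewrite [X in X @ _ --> _](_ : _ = (fun k =>
    \sum_(j < n) ((p j)%:E * \sum_(0 <= i < k) \d_(x j) (F i)))%E); last first.
  apply/funext => k; rewrite /atoms exchange_big/=; apply: eq_bigr => j _.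
  by rewrite ge0_sume_distrr.
apply: cvg_nnesum => j _.
  apply: nearW => k; apply: mule_ge0; first by rewrite lee_fin weight_ge0.
  exact: sume_ge0.
by apply: cvgeZl => //; exact: measure_semi_sigma_additive.
Qed.

HB.instance Definition _ := isMeasure.Build _ _ _ (atoms p x)
  atoms0 atoms_ge0 atoms_sigma_additive.

Let atoms_setT : atoms p x setT = 1%E.
Proof.
rewrite /atoms (eq_bigr (fun j => (p j)%:E)); last first.
  by move=> j _; rewrite diracT mule1.
by rewrite sumEFin weight_sum1.
Qed.

HB.instance Definition _ := Measure_isProbability.Build _ _ _ (atoms p x)
  atoms_setT.

End atoms_probability.

Definition best_approx (I : set R) (mu : probability (measurableTypeR R) R) n
    (p : simplex n) (x : 'I_n -> R) : Prop :=
  Xi I x /\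
  forall y : 'I_n -> R, Xi I y ->
    levy_dist I mu (atoms p x) <= levy_dist I mu (atoms p y).

End simplex.

Arguments simplex R n : clear implicits.

Section ell.
Context {R : realType}.
Implicit Types (f : R -> \bar R) (J : set R).

Definition linv f (t : R) : \bar R :=
  ereal_sup [set x%:E | x in [set x : R | (f x <= t%:E)%E]].

Definition llim f (x : R) : \bar R := lim (f y @[y --> x^'-]).
Definition rlim f (x : R) : \bar R := lim (f y @[y --> x^'+]).

(* Meant for non-decreasing f and nonempty bounded intervals J such that
   f_-(sup J) < +oo and f_+(inf J) > -oo; the set below is then nonempty. *)
Definition ell f J (x : R) : R :=
  inf [set y : R | 0 <= y /\
    (llim f (sup J - y) - y%:E <= x%:E)%E /\
    (x%:E <= rlim f (inf J + y) + y%:E)%E].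

(* The minimum value of ell f J over R: xget returns the least element of the
   range of ell f J when there is one. *)
Definition ell_min f J : R :=
  xget 0 [set m | range (ell f J) m /\ lbound (range (ell f J)) m].

(* All the terms are nonnegative, so the default value 0 is harmless. *)
Definition L_bullet (I : set R) (mu : probability (measurableTypeR R) R) n
    (p : simplex R n) : R :=
  \big[Num.max/0]_(j < n)
    ell_min (linv (distr_fun I mu)) `[psum p j, psum p j.+1].

End ell.

(* Main.v *)
Require Import Defs.
From mathcomp Require Import all_boot all_order all_algebra.
From mathcomp Require Import all_classical all_reals all_analysis.
From mathcomp Require Import lra.
Import Order.TTheory GRing.Theory Num.Theory.
Import numFieldNormedType.Exports.
Local Open Scope classical_set_scope.
Local Open Scope ring_scope.

(** Write F for the distribution function of mu, G for its quantile function
[linv F], and P_j for the partial sums of p.  The whole argument rests on one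
elementary condition, [fits F s t y x], saying that a jump from level s to
level t placed at x stays within the band of half-width y around the graph of
F:  t - y <= F (x + y), and F (z - y) <= s + y for all z < x.

On the quantile side, inverting F turns the two halves of this condition into
G_-(t - y) - y <= x and x <= G_+(s + y) + y.  Passing between strict and
non-strict inequalities costs an arbitrarily small increase of y, which an
infimum over y does not see; hence [ell G `[s, t] x <= c] holds if and only if
[fits F s t y x] holds for all y > c ([ell_leP]).

On the Levy side, the distribution function of the atomic measure is a step
function, so comparing it with the shifts of F need only be done at its jumps:
y is admissible in the definition of the Levy distance if and only if every
atom of positive weight satisfies [fits F P_j P_(j+1) y (x j)]
([levy_fitsP]).

Together: the Levy distance is at most omega * c if and only if every atom of
positive weight has ell-value at most c ([levy_dist_leP]).  What remains is to
minimise over x.  Each ell-value is at least [ell_min], and [ell_min] vanishes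
on one-point intervals ([ell_min_point]), so no configuration beats
omega * L_bullet.  Conversely the bound is reached by putting each atom at the
leftmost point of [a, b] compatible with the first half of the condition at
level c = L_bullet ([leftmost_fits]).  This leftmost point increases with t,
so the atoms so chosen are automatically ordered. *)

Set Implicit Arguments.
Unset Strict Implicit.
Unset Printing Implicit Defensive.

(** * Infima of sets of nonnegative reals *)

Section infimum.
Context {R : realType}.

(** The two sets interleave up to an arbitrarily small increase, so they have
the same infimum; T is the one whose membership is convenient to test. *)
Lemma inf_le_gtP (S T : set R) (c : R) :
  T !=set0 -> lbound S 0 -> T `<=` S ->
  (forall y z, S y -> y < z -> T z) ->
  (inf S <= c <-> forall y, c < y -> T y).
Proof.
move=> [y0 Ty0] S0 TS ST; split=> [Sc y cy|Tc].
  have [||z Sz zy] := @inf_lt _ S y; last exact: ST zy.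
  - by exists y0; exact: TS.
  - exact: le_lt_trans cy.
apply/unstable.ler_gtP => y cy; apply: ge_inf; first by exists 0.
exact/TS/Tc.
Qed.

Lemma inf_ge0 (S : set R) : lbound S 0 -> 0 <= inf S.
Proof.
have [->|/set0P S0] := eqVneq S set0; first by rewrite inf0.
exact: lb_le_inf.
Qed.

End infimum.

(** * One-sided limits of non-decreasing extended-real functions *)

Section one_sided_limits.
Context {R : realType} (f : R -> \bar R).
Hypothesis f_nd : {homo f : x y / x <= y >-> (x <= y)%E}.

Lemma is_cvg_llim x : cvg (f y @[y --> x^'-]).
Proof.
have : cvg ((f \o -%R) y @[y --> (- x)^'+]).
  apply: nonincreasing_at_right_is_cvge; apply: nearW => z u v _ _ uv.
  by apply: f_nd; rewrite lerN2.
by move=> /cvg_ex[l /cvg_at_leftNP fl]; apply/cvg_ex; exists l.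
Qed.

Lemma is_cvg_rlim x : cvg (f y @[y --> x^'+]).
Proof.
apply: nondecreasing_at_right_is_cvge; apply: nearW => z u v _ _.
exact: f_nd.
Qed.

Lemma le_llim w x : w < x -> (f w <= llim f x)%E.
Proof.
move=> wx; apply: lime_ge; first exact: is_cvg_llim.
near=> y; apply: f_nd; apply: ltW; near: y; exact: nbhs_left_gt.
Unshelve. all: by end_near. Qed.

Lemma llim_le x B : (forall w, w < x -> (f w <= B)%E) -> (llim f x <= B)%E.
Proof.
move=> fB; apply: lime_le; first exact: is_cvg_llim.
by near=> y; apply: fB; near: y; exact: nbhs_left_lt.
Unshelve. all: by end_near. Qed.

Lemma le_rlim x : (f x <= rlim f x)%E.
Proof.
apply: lime_ge; first exact: is_cvg_rlim.
by near=> y; apply: f_nd; apply: ltW; near: y; exact: nbhs_right_gt.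
Unshelve. all: by end_near. Qed.

Lemma rlim_le x w : x < w -> (rlim f x <= f w)%E.
Proof.
move=> xw; apply: lime_le; first exact: is_cvg_rlim.
by near=> y; apply: f_nd; apply: ltW; near: y; exact: nbhs_right_lt.
Unshelve. all: by end_near. Qed.

End one_sided_limits.

(** * The band condition on a jump, and the function ell *)

Section fits.
Context {R : realType}.

Record cdf_on (a b : R) (F : R -> R) : Prop := CdfOn {
  cdf_nd : {homo F : x y / x <= y} ;
  cdf_ge0 : forall x, 0 <= F x ;
  cdf_le1 : forall x, F x <= 1 ;
  cdf_lt : forall x, x < a -> F x = 0 ;
  cdf_ge : forall x, b <= x -> F x = 1 }.

(** A step function jumping from s to t at x respects there the band of
half-width y around F. *)
Definition fits (F : R -> R) (s t y x : R) : Prop :=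
  t - y <= F (x + y) /\ forall z, z < x -> F (z - y) <= s + y.

(** The consistency of the two halves of [fits F s t y], with x eliminated: a
point z too far left for the first half must be allowed by the second half, so
that x may lie to the right of z. *)
Definition feasible (F : R -> R) (s t y : R) : Prop :=
  forall z, F (z + y) < t - y -> F (z - y) <= s + y.

(** The first half of [fits] is required for all y > c, not just at c, so that
the infimum itself satisfies it. *)
Definition leftmost (a : R) (F : R -> R) (c t : R) : R :=
  inf [set x : R | a <= x /\ forall y : R, c < y -> t - y <= F (x + y)].

Context {a b : R} {F : R -> R} (cdfF : cdf_on a b F).
Let G := linv (fun x => (F x)%:E).
Let F_nd x y (xy : x <= y) : F x <= F y := cdf_nd cdfF xy.
#[local] Arguments F_nd : clear implicits.

Lemma fits_feasible (s t y x : R) : fits F s t y x -> feasible F s t y.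
Proof.
move=> [tF Fs] z zt; apply: Fs.
by rewrite ltNge; apply/negP => xz; have := F_nd (x + y) (z + y); lra.
Qed.

(** This is what makes one-point intervals harmless: without an actual jump,
the two halves of [fits] never compete. *)
Lemma feasible_point (s t y : R) : t <= s -> 0 <= y -> feasible F s t y.
Proof. by move=> ts y0 z; have := F_nd (z - y) (z + y); lra. Qed.

Lemma fits_le (s t y z x : R) : y <= z -> fits F s t y x -> fits F s t z x.
Proof.
move=> yz [tF Fs]; split=> [|w wx].
  by have := F_nd (x + y) (x + z); lra.
by have := F_nd (w - z) (w - y); have := Fs _ wx; lra.
Qed.

Lemma fits1 (s t x : R) : 0 <= s -> t <= 1 -> fits F s t 1 x.
Proof.
move=> s0 t1; split=> [|z _].
  by have := cdf_ge0 cdfF (x + 1); lra.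
by have := cdf_le1 cdfF (z - 1); lra.
Qed.

Lemma linv_nd : {homo G : u v / u <= v >-> (u <= v)%E}.
Proof.
move=> u v uv; apply: ereal_sup_le => _ [x /= Fx <-]; exists x => //=.
by apply: le_trans Fx _; rewrite lee_fin.
Qed.

(** The next four lemmas invert F.  Each converse direction loses an
arbitrarily small amount, in the argument of F or in the level. *)
Lemma llim_linv_le (u x : R) : u <= F x -> (llim G u <= x%:E)%E.
Proof.
move=> uF; apply: (llim_le linv_nd) => w wu.
apply: ge_ereal_sup => _ [z /= + <-].
rewrite !lee_fin => Fz; rewrite leNgt; apply/negP => xz.
by have := F_nd x z; lra.
Qed.

Lemma le_cdf_llim (u x y : R) : (llim G u <= x%:E)%E -> x < y -> u <= F y.
Proof.
move=> Gx xy; rewrite leNgt; apply/negP => Fu.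
have yG : (y%:E <= G (F y))%E by apply: ereal_sup_ubound; exists y => /=.
have := le_trans yG (le_trans (le_llim linv_nd Fu) Gx).
by rewrite lee_fin; lra.
Qed.

Lemma le_rlim_linv (u x : R) :
  (forall z, z < x -> F z <= u) -> (x%:E <= rlim G u)%E.
Proof.
move=> Fu; apply: le_trans (le_rlim linv_nd u).
have zG z : z < x -> (z%:E <= G u)%E.
  by move=> zx; apply: ereal_sup_ubound; exists z => //=; rewrite lee_fin Fu.
move: zG; case: (G u) => [g|//|] zG; rewrite ?leey// ?lee_fin.
  rewrite leNgt; apply/negP => gx.
  by have := zG ((g + x) / 2); rewrite lee_fin; lra.
have /zG : x - 1 < x by lra.
by rewrite leNgt ltNyr.
Qed.

Lemma cdf_le_rlim (u v x z : R) :
  (x%:E <= rlim G u)%E -> u < v -> z < x -> F z <= v.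
Proof.
move=> xG uv zx.
have : (z%:E < G v)%E.
  apply: lt_le_trans (le_trans xG (rlim_le linv_nd uv)); by rewrite lte_fin.
move=> /ereal_sup_gt[_ [w /= + <-]]; rewrite lee_fin lte_fin => Fw zw.
by apply: le_trans Fw; apply: F_nd; exact: ltW.
Qed.

(** The quantile inequalities defining ell say the same as [fits], up to an
arbitrarily small increase of y.  The value y = 1 is always admissible because
the levels lie in [[0, 1]]. *)
Lemma ell_leP (s t c x : R) : 0 <= s -> s <= t -> t <= 1 -> 0 <= c ->
  (ell G `[s, t] x <= c <-> forall y, c < y -> fits F s t y x).
Proof.
move=> s0 st t1 c0; rewrite /ell sup_itv ?bnd_simp// inf_itv ?bnd_simp//.
have -> : (forall y, c < y -> fits F s t y x) <->
    (forall y, c < y -> [set y | 0 <= y /\ fits F s t y x] y).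
  by split=> H y cy; [split; [lra|exact: H]|case: (H y cy)].
apply: inf_le_gtP.
- by exists 1; split => //; exact: fits1.
- by move=> y [].
- move=> y [y0 [tF Fs]]; split => //; split.
    by rewrite leeBlDr// -EFinD; exact: llim_linv_le.
  rewrite -leeBlDr// -EFinB; apply: le_rlim_linv => z zx.
  by have := Fs (z + y); rewrite addrK; apply; lra.
- move=> y z [y0 [+ +]] yz; rewrite leeBlDr// -EFinD -leeBlDr// -EFinB.
  move=> Gx xG; split; first lra; split.
    by have := @le_cdf_llim _ _ (x + z) Gx; lra.
  by move=> w wx; apply: cdf_le_rlim xG _ _; lra.
Qed.

Lemma ell_ge0 (J : set R) (x : R) : 0 <= ell G J x.
Proof. by apply: inf_ge0 => y []. Qed.

(** * An optimal position for one jump *)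

Let leftmost_cond (c t : R) : set R :=
  [set x : R | a <= x /\ forall y : R, c < y -> t - y <= F (x + y)].

Let leftmost_condb (c t : R) :
  a <= b -> 0 <= c -> t <= 1 -> leftmost_cond c t b.
Proof. by move=> ab c0 t1; split => // y cy; rewrite (cdf_ge cdfF); lra. Qed.

Let leftmost_condN0 (c t : R) :
  a <= b -> 0 <= c -> t <= 1 -> leftmost_cond c t !=set0.
Proof. by move=> ab c0 t1; exists b; exact: leftmost_condb. Qed.

Let has_lbound_leftmost (c t : R) : has_lbound (leftmost_cond c t).
Proof. by exists a => x []. Qed.

Lemma leftmost_itv (c t : R) : a <= b -> 0 <= c -> t <= 1 ->
  a <= leftmost a F c t <= b.
Proof.
move=> ab c0 t1; apply/andP; split.
  by apply: lb_le_inf => [|x []//]; exact: leftmost_condN0.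
by apply: ge_inf; [exact: has_lbound_leftmost|exact: leftmost_condb].
Qed.

Lemma le_leftmost (c t u : R) : a <= b -> 0 <= c -> t <= u -> u <= 1 ->
  leftmost a F c t <= leftmost a F c u.
Proof.
move=> ab c0 tu u1; apply: lb_le_inf; first exact: leftmost_condN0.
move=> x [ax xF]; apply: ge_inf; first exact: has_lbound_leftmost.
by split => // y cy; have := xF y cy; lra.
Qed.

(** The first half of [fits] survives the passage to the infimum since y > c
leaves room to move by (y - c) / 2.  For the second half, a point z < leftmost
fails the first half at some u > c, so feasibility at the smaller of u and y
bounds F (z - y). *)
Lemma leftmost_fits (c s t : R) : a <= b -> 0 <= c -> 0 <= s -> t <= 1 ->
  (forall y, c < y -> feasible F s t y) ->
  forall y, c < y -> fits F s t y (leftmost a F c t).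
Proof.
move=> ab c0 s0 t1 feas y cy; split=> [|z zx].
  (* Split the gap y - c between the position and the half-width. *)
  have [||x [ax xF] xl] :=
      @inf_lt _ (leftmost_cond c t) (leftmost a F c t + (y - c) / 2).
  - exact: leftmost_condN0.
  - by rewrite -/(leftmost a F c t); lra.
  have := xF ((c + y) / 2).
  by have := F_nd (x + (c + y) / 2) (leftmost a F c t + y); lra.
have [za|az] := ltP z a; first by rewrite (cdf_lt cdfF); lra.
have : ~ leftmost_cond c t z.
  move=> cz; have := ge_inf (has_lbound_leftmost c t) cz.
  by rewrite -/(leftmost a F c t); lra.
move=> /not_andP[//|/existsNP[u /not_implyP[cu /negP]]]; rewrite -ltNge => Fu.
have [uy|yu] := leP u y.
  by have := feas u cu z Fu; have := F_nd (z - y) (z - u); lra.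
by apply: (feas y cy); have := F_nd (z + y) (z + u); lra.
Qed.

(** The minimiser is [leftmost] at c, the infimum of ell: for y > c some
position fits, hence [leftmost] does too. *)
Lemma ell_argmin (s t : R) : a <= b -> 0 <= s -> s <= t -> t <= 1 ->
  exists x, forall z, ell G `[s, t] x <= ell G `[s, t] z.
Proof.
move=> ab s0 st t1; set c := inf (range (ell G `[s, t])).
have lb0 : has_lbound (range (ell G `[s, t])).
  by exists 0 => _ [z _ <-]; exact: ell_ge0.
have c0 : 0 <= c.
  by apply: inf_ge0 => _ [z _ <-]; exact: ell_ge0.
exists (leftmost a F c t) => z; apply: (@le_trans _ _ c); last first.
  by apply: ge_inf => //; exists z.
apply/ell_leP => //; apply: leftmost_fits => // y cy.
have [||_ [x _ <-] xy] := @inf_lt _ (range (ell G `[s, t])) y => //.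
  by exists (ell G `[s, t] 0), 0.
apply: (@fits_feasible s t y x).
by move/ell_leP : (lexx (ell G `[s, t] x)); apply => //; exact: ell_ge0.
Qed.

Lemma ell_min_attained (s t : R) : a <= b -> 0 <= s -> s <= t -> t <= 1 ->
  exists2 x, ell G `[s, t] x = ell_min G `[s, t] &
             forall z, ell_min G `[s, t] <= ell G `[s, t] z.
Proof.
move=> ab s0 st t1; have [x xmin] := ell_argmin ab s0 st t1.
rewrite /ell_min; case: xgetP => [_ _ [[w _ <-] wmin]|/(_ (ell G `[s, t] x))[]].
  by exists w => // z; apply: wmin; exists z.
by split; [exists x|move=> _ [z _ <-]].
Qed.

Lemma ell_min_point (s : R) :
  a <= b -> 0 <= s -> s <= 1 -> ell_min G `[s, s] = 0.
Proof.
move=> ab s0 s1; have [x ex emin] := ell_min_attained ab s0 (lexx s) s1.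
apply/eqP; rewrite eq_le; apply/andP; split; last by rewrite -ex ell_ge0.
apply: le_trans (emin (leftmost a F 0 s)) _; apply/ell_leP => //.
by apply: leftmost_fits => // y y0; apply: feasible_point => //; exact: ltW.
Qed.

End fits.

(** * Step functions in a band around a distribution function *)

Section weights.
Context {R : realType} {n : nat} (p : simplex R n).

Lemma le_sum_weight (P Q : pred 'I_n) :
  (forall i, 0 < p i -> P i -> Q i) ->
  \sum_(i < n | P i) p i <= \sum_(i < n | Q i) p i.
Proof.
move=> PQ; rewrite big_mkcond [leRHS]big_mkcond/=; apply: ler_sum => i _.
have := weight_ge0 p i; rewrite le_eqVlt => /predU1P[<-|p0].
  by rewrite !if_same.
by case: ifPn => [/(PQ i p0)->//|_]; case: ifP => // _; exact: ltW.
Qed.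

Lemma psum_ge0 i : 0 <= psum p i.
Proof. by apply: sumr_ge0 => j _; exact: weight_ge0. Qed.

Lemma le_psum i j : (i <= j)%N -> psum p i <= psum p j.
Proof. by move=> ij; apply: le_sum_weight => k _ /leq_trans; apply. Qed.

Lemma psum_le1 i : psum p i <= 1.
Proof. by rewrite -(weight_sum1 p); apply: le_sum_weight. Qed.

Lemma psumS (j : 'I_n) : psum p j.+1 = psum p j + p j.
Proof.
rewrite /psum (bigD1 j)/= ?ltnSn// addrC; congr (_ + _).
by apply: eq_bigl => i; rewrite ltnS [RHS]ltn_neqAle andbC.
Qed.

(** A step function is compared with a monotone function at its jumps only.
To bound it at t from below (above), use the first jump to the right of t (the
last jump up to t); zero weights are skipped since they make no jump. *)
Lemma levy_fitsP (F : R -> R) (a b y : R) (x : 'I_n -> R) :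
  cdf_on a b F -> (forall i j : 'I_n, (i <= j)%N -> x i <= x j) -> 0 <= y ->
  (forall t, F (t - y) - y <= \sum_(j < n | x j <= t) p j /\
             \sum_(j < n | x j <= t) p j <= F (t + y) + y) <->
  (forall j : 'I_n, 0 < p j -> fits F (psum p j) (psum p j.+1) y (x j)).
Proof.
move=> cdfF x_nd y0; split=> [levy j p0|fit t].
  split=> [|z zx].
    have [_] := levy (x j).
    suff : psum p j.+1 <= \sum_(i < n | x i <= x j) p i by lra.
    by apply: le_sum_weight => i _; rewrite ltnS; exact: x_nd.
  have [+ _] := levy z.
  suff : \sum_(i < n | x i <= z) p i <= psum p j by lra.
  apply: le_sum_weight => i _ xz; rewrite ltnNge; apply/negP => /x_nd.
  by lra.
split.
- have [j0 /andP[pj0 tj0]|none] := pickP [pred j | (0 < p j) && (t < x j)].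
    have [j /andP[pj tj] jmin] := arg_minnP (fun i : 'I_n => i : nat)
      (P := [pred j | (0 < p j) && (t < x j)])
      (i0 := j0) (introT andP (conj pj0 tj0)).
    have [_ /(_ t tj)] := fit j pj.
    suff : psum p j <= \sum_(i < n | x i <= t) p i by lra.
    apply: le_sum_weight => i pi ij; rewrite leNgt; apply/negP => ti.
    by have := jmin i; rewrite /= pi ti => /(_ isT); rewrite leqNgt ij.
  have := cdf_le1 cdfF (t - y).
  suff : \sum_(j < n) p j <= \sum_(j < n | x j <= t) p j.
    by rewrite weight_sum1; lra.
  apply: le_sum_weight => i pi _.
  by have := none i; rewrite /= pi /= leNgt => ->.
- have [j0 /andP[pj0 tj0]|none] := pickP [pred j | (0 < p j) && (x j <= t)].
    have [j /andP[pj tj] jmax] := arg_maxnP (fun i : 'I_n => i : nat)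
      (P := [pred j | (0 < p j) && (x j <= t)])
      (i0 := j0) (introT andP (conj pj0 tj0)).
    have [+ _] := fit j pj.
    have : F (x j + y) <= F (t + y) by apply: (cdf_nd cdfF); lra.
    suff : \sum_(i < n | x i <= t) p i <= psum p j.+1 by lra.
    apply: le_sum_weight => i pi ti.
    by have := jmax i; rewrite /= pi ti => /(_ isT); rewrite ltnS.
  have := cdf_ge0 cdfF (t + y).
  suff : \sum_(j < n | x j <= t) p j <= \sum_(j < n | false) p j.
    by rewrite big_pred0_eq; lra.
  by apply: le_sum_weight => i pi; have := none i; rewrite /= pi /= => ->.
Qed.

End weights.

(** * The Levy distance to an atomic measure *)

Section measures.
Context {R : realType} {a b : R}.
Let I : set R := `[a, b]%classic.

Lemma distr_funE (mu : probability (measurableTypeR R) R) x :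
  distr_fun I mu x = mu (I `&` `]-oo, x]).
Proof. by congr (mu _); apply/seteqP; split => y /=; rewrite !in_itv. Qed.

Lemma distr_fun_cdf (mu : probability (measurableTypeR R) R) : mu I = 1%E ->
  exists2 F, cdf_on a b F & distr_fun I mu = fun x => (F x)%:E.
Proof.
move=> mu1.
have mI x : measurable (I `&` `]-oo, x] : set (measurableTypeR R)).
  by apply: measurableI; exact: measurable_itv.
have dE x : distr_fun I mu x = (fine (distr_fun I mu x))%:E.
  by rewrite fineK// distr_funE fin_num_measure.
exists (fun x => fine (distr_fun I mu x)); last exact/funext.
split.
- move=> x y xy; rewrite -lee_fin -!dE !distr_funE; apply: le_measure;
    rewrite ?inE//.
  by apply: setIS => z /=; rewrite !in_itv/= => /le_trans; apply.
- by move=> x; rewrite -lee_fin -dE.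
- by move=> x; rewrite -lee_fin -dE distr_funE probability_le1.
- move=> x xa; rewrite (_ : distr_fun I mu x = 0%E)// distr_funE.
  rewrite -(measure0 mu); congr (mu _); rewrite -subset0 => z /= [].
  by rewrite /I/= !in_itv/=; lra.
- move=> x bx; rewrite (_ : distr_fun I mu x = 1%E)// distr_funE -mu1.
  by congr (mu _); apply: setIidl => z; rewrite /I/= !in_itv/=; lra.
Qed.

Lemma distr_fun_atoms n (p : simplex R n) (x : 'I_n -> R) t :
  (forall j, I (x j)) ->
  distr_fun I (atoms p x) t = (\sum_(j < n | x j <= t) p j)%:E.
Proof.
move=> Ix; rewrite /distr_fun/= /atoms -sumEFin [RHS]big_mkcond/=.
apply: eq_bigr => j _; rewrite diracE.
case: ifPn => [xt|/negP xt]; first by rewrite mem_set// mule1.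
by rewrite memNset ?mule0// => -[].
Qed.

(** Both sides amount to the band condition for all y > c at every atom of
positive weight. *)
Lemma levy_dist_leP (mu : probability (measurableTypeR R) R) n
    (p : simplex R n) (x : 'I_n -> R) (c : R) :
  0 < omega I -> mu I = 1%E -> Xi I x -> 0 <= c ->
  (levy_dist I mu (atoms p x) <= omega I * c <->
   forall j : 'I_n, psum p j < psum p j.+1 ->
     ell (linv (distr_fun I mu)) `[psum p j, psum p j.+1] (x j) <= c).
Proof.
move=> w0 mu1 [Ix x_nd] c0; have [F cdfF FE] := distr_fun_cdf mu1.
rewrite /levy_dist ler_pM2l// FE; set S := (X in inf X).
have SE y : S y <-> 0 <= y /\
    forall j : 'I_n, 0 < p j -> fits F (psum p j) (psum p j.+1) y (x j).
  split=> -[y0 H]; split => //.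
    apply/(levy_fitsP p cdfF x_nd y0) => t; have := H t.
    by rewrite distr_fun_atoms// -EFinB -EFinD !lee_fin.
  move=> t; rewrite distr_fun_atoms// -EFinB -EFinD !lee_fin.
  by move/(levy_fitsP p cdfF x_nd y0) : H; apply.
have S1 : S 1.
  by apply/SE; split => // j _; apply: (fits1 cdfF); rewrite ?psum_ge0 ?psum_le1.
have -> : inf S <= c <-> forall y, c < y -> S y.
  apply: inf_le_gtP => //; [by exists 1|by move=> y []|].
  move=> y z /SE[y0 fit] yz; apply/SE; split; first lra.
  by move=> j pj; apply: (fits_le cdfF) (ltW yz) _; exact: fit.
have ellP j := ell_leP cdfF (x j) (psum_ge0 p j)
  (le_psum p (leqnSn j)) (psum_le1 p j.+1) c0.
split=> [Sc j|ellc y cy].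
  by rewrite psumS ltrDl => pj; rewrite -psumS; apply/ellP => y /Sc/SE[_]; apply.
apply/SE; split=> [|j pj]; first lra.
by move: y cy; apply/ellP/ellc; rewrite psumS ltrDl.
Qed.

End measures.

Unset Implicit Arguments.
Set Strict Implicit.

Theorem proposition3p6 (R : realType) (a b : R) (I : set R)
    (I_def : I = `[a, b]%classic)
    (I_gt0 : (0 < lebesgue_measure I)%E)
    (mu : probability (measurableTypeR R) R) (mu_I : mu I = 1%E)
    (n : nat) (n_gt0 : (0 < n)%N) (p : simplex R n) :
  (exists x : 'I_n -> R, best_approx I mu p x) /\
  (forall x : 'I_n -> R, Xi I x ->
    (best_approx I mu p x <->
      (forall j : 'I_n, psum p j < psum p j.+1 ->
        ell (linv (distr_fun I mu)) `[psum p j, psum p j.+1] (x j)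
          <= L_bullet I mu p)) /\
    (best_approx I mu p x ->
      levy_dist I mu (atoms p x) = omega I * L_bullet I mu p)).
Proof.
subst I; set I := `[a, b]%classic in I_gt0 mu_I *.
have [F cdfF FE] := distr_fun_cdf mu_I.
have ab : a < b.
  move: I_gt0; rewrite /I lebesgue_measure_itv/= lte_fin.
  by case: ifP => //; rewrite ltxx.
have w0 : 0 < omega I.
  rewrite /omega /I lebesgue_measure_itv/= lte_fin ab/=.
  by rewrite divr_gt0 ?subr_gt0// lt_max ltr01.
set G := linv (distr_fun I mu); set M := L_bullet I mu p.
have M0 : 0 <= M by exact: bigmax_ge_id.
have emin j := ell_min_attained cdfF (ltW ab)
  (psum_ge0 p j) (le_psum p (leqnSn j)) (psum_le1 p j.+1).
have levy_ge z : Xi I z -> omega I * M <= levy_dist I mu (atoms p z).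
  move=> Iz; set D := levy_dist I mu (atoms p z).
  have DE : D = omega I * (D / omega I) by rewrite mulrC divfK ?gt_eqF.
  have D0 : 0 <= D / omega I.
    apply: divr_ge0; last exact: ltW.
    by apply: mulr_ge0; [exact: ltW|apply: inf_ge0 => y []].
  rewrite DE ler_pM2l//; apply/bigmax_leP; split => // j _.
  (* One-point intervals enter L_bullet without constraining z. *)
  have [pj|pj] := ltP (psum p j) (psum p j.+1); last first.
    have -> : psum p j.+1 = psum p j by apply/le_anti; rewrite pj le_psum.
    by rewrite FE (ell_min_point cdfF) ?psum_ge0 ?psum_le1// ltW.
  move: (lexx D); rewrite {2}DE => /(levy_dist_leP p w0 mu_I Iz D0).
  move=> /(_ j pj); apply: le_trans; rewrite FE.
  by have [_ _] := emin j; apply.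
(* One common half-width M for all atoms keeps the positions ordered. *)
pose x0 (j : 'I_n) := leftmost a F M (psum p j.+1).
have Ix0 : Xi I x0.
  split=> [j|i j ij]; last first.
    by apply: (le_leftmost cdfF) => //; rewrite ?le_psum ?psum_le1 ?(ltW ab).
  by rewrite /I/= in_itv/=; apply: (leftmost_itv cdfF);
    rewrite ?psum_le1 ?(ltW ab).
have levy_x0 : levy_dist I mu (atoms p x0) <= omega I * M.
  apply/levy_dist_leP => // j _; rewrite FE.
  have ellP z := ell_leP cdfF z (psum_ge0 p j)
    (le_psum p (leqnSn j)) (psum_le1 p j.+1) M0.
  apply/ellP; apply: (leftmost_fits cdfF) => //;
    rewrite ?psum_ge0 ?psum_le1 ?(ltW ab)//.
  have [z zE _] := emin j.
  have /ellP fit : ell (linv (fun x => (F x)%:E)) `[psum p j, psum p j.+1] z <= M.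
    rewrite zE -FE.
    exact: (le_bigmax 0 (fun i : 'I_n => ell_min G `[psum p i, psum p i.+1])).
  by move=> y /fit; exact: (fits_feasible cdfF).
have bestP x : Xi I x ->
    best_approx I mu p x <-> levy_dist I mu (atoms p x) <= omega I * M.
  move=> Ix; split=> [[_ /(_ _ Ix0)/le_trans]|xM]; first exact.
  by split => // z Iz; exact: le_trans (levy_ge z Iz).
split; first by exists x0; exact/bestP.
move=> x Ix; split; first by rewrite bestP// levy_dist_leP.
by move=> /(bestP x Ix) xM; apply/le_anti; rewrite xM levy_ge.
Qed.
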